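(* Let $n\ge2$, $G=\mathrm{PU}(n)\rtimes\langle\tau_0\rangle$ and $\tilde G=(\mathrm U(n)/\langle -I\rangle)\rtimes\langle\tau\rangle$. If $F$ is an abelian subgroup of $G$ not contained in $G_0$, then there exists an abelian subgroup $F'$ of $\tilde G$ such that $\pi'(F')=F$ and $F'\cap(\mathrm Z_n/\langle -I\rangle)=\langle iI\rangle/\langle -I\rangle$. Given $F$, such an $F'$ is determined up to conjugation by an element of $\mathrm Z_n/\langle -I\rangle$.
   Context: $\mathrm Z_n=\{\lambda I_n:|\lambda|=1\}$, $\mathrm{PU}(n)=\mathrm U(n)/\mathrm Z_n$. In $G$, $\tau_0$ is complex conjugation: $\tau_0^2=1$ and $\tau_0[A]\tau_0^{-1}=[\overline A]$ for $A\in\mathrm U(n)$; $G_0=\mathrm{PU}(n)$ is the neutral component. In $\tilde G$, $\tau^2=1$ and $\tau[A]\tau^{-1}=[\overline A]$. $\pi':\tilde G\to G$ is the natural projection, $[A]\mapsto[A]$, $\tau\mapsto\tau_0$; its kernel is $\mathrm Z_n/\langle -I\rangle$. *)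

(* Defs.v *)
From HB Require Import structures.
From mathcomp Require Import all_boot all_order all_algebra.
From mathcomp Require Import boolp classical_sets reals.
From mathcomp Require Import complex.

Set Implicit Arguments.
Unset Strict Implicit.
Unset Printing Implicit Defensive.

Import Order.TTheory GRing.Theory Num.Theory.

Local Open Scope quotient_scope.
Local Open Scope classical_set_scope.
Local Open Scope group_scope.

Definition subgroup (G : groupType) (H : set G) : Prop := group_closed (mem H).

Lemma subgroupP (G : groupType) (H : set G) :
  subgroup H <->
  [/\ H 1, forall x y, H x -> H y -> H (x * y) & forall x, H x -> H x^-1].
Proof.
split=> [H_grp | [H1 HM HV]].
  split=> [|x y Hx Hy|x Hx]; apply: set_mem.
  - exact: H_grp.1.
  - by apply: (group_closedM H_grp); exact: mem_set.
  - by apply: (group_closedV H_grp); exact: mem_set.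
split; first exact: mem_set.
move=> x y /set_mem Hx /set_mem Hy; apply: mem_set.
by apply: HM => //; exact: HV.
Qed.

Definition abelian_set (G : groupType) (H : set G) : Prop :=
  forall x y, H x -> H y -> commute x y.

Definition generated (G : groupType) (A : set G) : set G :=
  \bigcap_(H in [set H | subgroup H /\ A `<=` H]) H.

(* z H z^-1; the library's [conjg x z] is z^-1 x z *)
Definition conj_set (G : groupType) (z : G) (H : set G) : set G :=
  [set z * x * z^-1 | x in H].

Record normal_subgroup (G : groupType) := NormalSubgroup {
  normal_set :> set G;
  normal_group : subgroup normal_set;
  normal_conj : forall x y, normal_set x -> normal_set (x ^ y) }.

Lemma generated_subgroup (G : groupType) (A : set G) : subgroup (generated A).
Proof.
apply/subgroupP; split=> [H [/subgroupP[]]|x y Hx Hy H HA|x Hx H HA] //.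
- have /subgroupP[_ HM _] := HA.1.
  by apply: HM; [exact: Hx|exact: Hy].
- have /subgroupP[_ _ HV] := HA.1.
  by apply: HV; exact: Hx.
Qed.

Lemma generated1_commute (G : groupType) (a : G) :
  (forall y, commute a y) -> forall x y, generated [set a] x -> commute x y.
Proof.
move=> a_central x y.
have H_grp : subgroup [set z : G | forall t, commute z t].
  apply/subgroupP; split=> [t|u v Hu Hv t|u Hu t] /=.
  - by apply/commute_sym/commute1.
  - by apply/commute_sym/commuteM; exact/commute_sym.
  - by apply/commute_sym/commuteV; exact/commute_sym.
by move/(_ [set z : G | forall t, commute z t]); apply; split=> // z ->.
Qed.

Lemma generated1_central_conj (G : groupType) (a : G) :
  (forall y, commute a y) ->
  forall x y, generated [set a] x -> generated [set a] (x ^ y).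
Proof.
move=> a_central x y Hx; rewrite /conjg.
by rewrite (generated1_commute a_central y Hx) mulgA mulVg mul1g.
Qed.

Section Quotient.
Variables (G : groupType) (N : normal_subgroup G).

Definition coset_rel : rel G := fun x y => `[< normal_set N (x^-1 * y) >].

Fact coset_rel_refl : reflexive coset_rel.
Proof.
by move=> x; apply/asboolP; rewrite mulVg; case/subgroupP: (normal_group N).
Qed.

Fact coset_rel_sym : symmetric coset_rel.
Proof.
have [_ _ HV] := (subgroupP _).1 (normal_group N).
suff imp x y : coset_rel x y -> coset_rel y x.
  by move=> x y; apply/idP/idP; exact: imp.
by move/asboolP=> /HV; rewrite invgM invgK => h; exact/asboolP.
Qed.

Fact coset_rel_trans : transitive coset_rel.
Proof.
have [_ HM _] := (subgroupP _).1 (normal_group N).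
move=> y x z /asboolP hxy /asboolP hyz; apply/asboolP.
by have := HM _ _ hxy hyz; rewrite mulgA mulgK.
Qed.

Canonical coset_equiv :=
  EquivRel coset_rel coset_rel_refl coset_rel_sym coset_rel_trans.

Definition quotient_group := {eq_quot coset_rel}.

HB.instance Definition _ := Choice.on quotient_group.
HB.instance Definition _ := EqQuotient.on quotient_group.

Definition quot_class (x : G) : quotient_group := \pi_quotient_group x.

Lemma eq_quot_class (x y : G) :
  quot_class x = quot_class y <-> normal_set N (x^-1 * y).
Proof. by split=> [/eqquotP/asboolP|h] //; apply/eqquotP/asboolP. Qed.

Lemma quot_classP (x : quotient_group) : exists a, x = quot_class a.
Proof. by exists (repr x); rewrite /quot_class reprK. Qed.

Lemma quot_repr (x : G) : normal_set N ((repr (quot_class x))^-1 * x).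
Proof. by apply/eq_quot_class; rewrite /quot_class reprK. Qed.

Definition quot_one : quotient_group := quot_class 1.
Definition quot_mul (x y : quotient_group) : quotient_group :=
  quot_class (repr x * repr y).
Definition quot_inv (x : quotient_group) : quotient_group :=
  quot_class (repr x)^-1.

Lemma quot_mulE (x y : G) :
  quot_mul (quot_class x) (quot_class y) = quot_class (x * y).
Proof.
have [_ HM _] := (subgroupP _).1 (normal_group N).
apply/eq_quot_class; set a := repr _; set b := repr _.
have -> : (a * b)^-1 * (x * y) = (a^-1 * x) ^ b * (b^-1 * y).
  by rewrite /conjg invgM !mulgA mulgK.
by apply: HM; [apply: normal_conj|]; exact: quot_repr.
Qed.

Lemma quot_invE (x : G) : quot_inv (quot_class x) = quot_class x^-1.
Proof.
have [_ _ HV] := (subgroupP _).1 (normal_group N).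
apply/eq_quot_class; set a := repr _; rewrite invgK.
have -> : a * x^-1 = (a^-1 * x)^-1 ^ a^-1.
  by rewrite /conjg invgM !invgK !mulgA mulgK.
by apply/normal_conj/HV; exact: quot_repr.
Qed.

Fact quot_mulA : associative quot_mul.
Proof.
move=> x y z; have [a ->] := quot_classP x; have [b ->] := quot_classP y.
by have [c ->] := quot_classP z; rewrite !quot_mulE mulgA.
Qed.

Fact quot_mul1g : left_id quot_one quot_mul.
Proof. by move=> x; have [a ->] := quot_classP x; rewrite quot_mulE mul1g. Qed.

Fact quot_mulg1 : right_id quot_one quot_mul.
Proof. by move=> x; have [a ->] := quot_classP x; rewrite quot_mulE mulg1. Qed.

Fact quot_mulVg : left_inverse quot_one quot_inv quot_mul.
Proof.
by move=> x; have [a ->] := quot_classP x; rewrite quot_invE quot_mulE mulVg.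
Qed.

Fact quot_mulgV : right_inverse quot_one quot_inv quot_mul.
Proof.
by move=> x; have [a ->] := quot_classP x; rewrite quot_invE quot_mulE mulgV.
Qed.

HB.instance Definition _ := isGroup.Build quotient_group
  quot_mulA quot_mul1g quot_mulg1 quot_mulVg quot_mulgV.

Lemma quot_classM : {morph quot_class : x y / x * y}.
Proof. by move=> x y; rewrite -[LHS]quot_mulE. Qed.

End Quotient.

Arguments quot_class {G} N x.

(* The map G/N -> H/M induced by f; it is the expected one when f is a
   homomorphism with f(N) in M, see [quot_mapE] *)
Definition quot_map (G H : groupType) (N : normal_subgroup G)
    (M : normal_subgroup H) (f : G -> H) (x : quotient_group N) :
    quotient_group M :=
  quot_class M (f (repr x)).

Lemma quot_mapE (G H : groupType) (N : normal_subgroup G)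
    (M : normal_subgroup H) (f : G -> H) :
  {morph f : x y / x * y} -> (forall x, normal_set N x -> normal_set M (f x)) ->
  forall x, quot_map M f (quot_class N x) = quot_class M (f x).
Proof.
move=> fM fN x; apply/eq_quot_class.
have f1 : f 1 = 1 by apply: (mulgI (f 1)); rewrite -fM !mulg1.
have fV y : f y^-1 = (f y)^-1 by apply: (mulgI (f y)); rewrite -fM !mulgV.
by rewrite -fV -fM; apply: fN; exact: quot_repr.
Qed.

Record involutive_aut (G : groupType) := InvolutiveAut {
  inv_aut :> G -> G;
  inv_autM : {morph inv_aut : x y / x * y};
  inv_autK : involutive inv_aut }.

(* The semidirect product of G by <t>, with t^2 = 1 and t g t^-1 = s g; the
   pair (g, b) stands for g t^b *)
Definition sdprod2 (G : groupType) (s : involutive_aut G) : Type :=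
  (G * bool)%type.

Section SemiDirect.
Variables (G : groupType) (s : involutive_aut G).
Local Notation semidirect := (sdprod2 s).

HB.instance Definition _ := Choice.copy semidirect (G * bool)%type.

Definition aut_pow (b : bool) (g : G) : G := if b then s g else g.

Definition sd_one : semidirect := (1, false).
Definition sd_mul (x y : semidirect) : semidirect :=
  (x.1 * aut_pow x.2 y.1, x.2 (+) y.2).
Definition sd_inv (x : semidirect) : semidirect := (aut_pow x.2 x.1^-1, x.2).

Lemma inv_aut1 : s 1 = 1.
Proof. by apply: (mulgI (s 1)); rewrite -inv_autM !mulg1. Qed.

Fact sd_mulA : associative sd_mul.
Proof.
move=> [x a] [y b] [z c]; congr (_, _) => /=; last by rewrite addbA.
by case: a; case: b; rewrite /= ?inv_autM ?inv_autK mulgA.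
Qed.

Fact sd_mul1g : left_id sd_one sd_mul.
Proof. by case=> x a; rewrite /sd_mul /= mul1g. Qed.

Fact sd_mulg1 : right_id sd_one sd_mul.
Proof. by case=> x [] ; rewrite /sd_mul /= ?inv_aut1 mulg1. Qed.

Fact sd_mulVg : left_inverse sd_one sd_inv sd_mul.
Proof. by case=> x []; rewrite /sd_mul /= -?inv_autM mulVg ?inv_aut1. Qed.

Fact sd_mulgV : right_inverse sd_one sd_inv sd_mul.
Proof. by case=> x []; rewrite /sd_mul /= ?inv_autK mulgV. Qed.

HB.instance Definition _ := isGroup.Build semidirect
  sd_mulA sd_mul1g sd_mulg1 sd_mulVg sd_mulgV.

Definition sd_embed (g : G) : semidirect := (g, false).
Definition sd_tau : semidirect := (1, true).

Lemma sd_embedM : {morph sd_embed : x y / x * y}.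
Proof. by []. Qed.

Lemma sd_tauK : sd_tau * sd_tau = 1.
Proof. by congr (_, _); rewrite /= inv_aut1 mulg1. Qed.

Lemma sd_tauJ (g : G) : sd_tau * sd_embed g * sd_tau^-1 = sd_embed (s g).
Proof. by congr (_, _); rewrite /= mul1g invg1 !inv_aut1 mulg1. Qed.

Lemma sd_pairE (g : G) (b : bool) :
  (g, b) = sd_embed g * (if b then sd_tau else 1) :> semidirect.
Proof. by case: b; congr (_, _); rewrite /= mulg1. Qed.

End SemiDirect.

Arguments sd_embed {G} s g.

Section UnitaryGroup.
Variables (R : realType) (n : nat).
Local Notation C := R[i].

Record unitary_group := Unitary {
  U_val :> 'M[C]_n;
  U_valP : U_val \is unitarymx }.

HB.instance Definition _ := [isSub for U_val].
HB.instance Definition _ := [Choice of unitary_group by <:].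

Fact unitary1 : (1%:M%R : 'M[C]_n) \is unitarymx.
Proof. by apply/unitarymxP; rewrite trmx1 map_mx1 mulmx1. Qed.

Fact unitary_inv (A : 'M[C]_n) :
  A \is unitarymx -> invmx A \is unitarymx.
Proof. by move=> hA; rewrite invmx_unitary // trmxC_unitary. Qed.

Definition U_one : unitary_group := Unitary unitary1.
Definition U_mul (A B : unitary_group) : unitary_group :=
  Unitary (mul_unitarymx (U_valP A) (U_valP B)).
Definition U_inv (A : unitary_group) : unitary_group :=
  Unitary (unitary_inv (U_valP A)).

Fact U_mulA : associative U_mul.
Proof. by move=> A B D; apply: val_inj; rewrite /= mulmxA. Qed.

Fact U_mul1g : left_id U_one U_mul.
Proof. by move=> A; apply: val_inj; rewrite /= mul1mx. Qed.

Fact U_mulg1 : right_id U_one U_mul.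
Proof. by move=> A; apply: val_inj; rewrite /= mulmx1. Qed.

Fact U_mulVg : left_inverse U_one U_inv U_mul.
Proof.
move=> A; apply: val_inj; rewrite /= mulVmx //.
exact: unitarymx_unit (U_valP A).
Qed.

Fact U_mulgV : right_inverse U_one U_inv U_mul.
Proof.
move=> A; apply: val_inj; rewrite /= mulmxV //.
exact: unitarymx_unit (U_valP A).
Qed.

HB.instance Definition _ := isGroup.Build unitary_group
  U_mulA U_mul1g U_mulg1 U_mulVg U_mulgV.

Fact U_conj_subproof (A : unitary_group) :
  map_mx (Num.conj : C -> C) A \is unitarymx.
Proof. by rewrite conjC_unitary; exact: (U_valP A). Qed.

Definition U_conj (A : unitary_group) : unitary_group :=
  Unitary (U_conj_subproof A).

Fact U_conjM : {morph U_conj : A B / A * B}.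
Proof. by move=> A B; apply: val_inj; rewrite /= map_mxM. Qed.

Fact U_conjK : involutive U_conj.
Proof.
by move=> A; apply: val_inj; apply/matrixP=> i j; rewrite !mxE conjCK.
Qed.

Fact scalar_unitary (l : C) : (`|l| = 1)%R -> (l%:M%R : 'M[C]_n) \is unitarymx.
Proof.
move=> l1; apply/unitarymxP.
by rewrite tr_scalar_mx map_scalar_mx -scalar_mxM -normCK l1 expr1n.
Qed.

Definition U_scalar (l : C) (l1 : (`|l| = 1)%R) : unitary_group :=
  Unitary (scalar_unitary l1).

Definition U_negI : unitary_group := U_scalar (@normrN1 C).
Definition U_iI : unitary_group := U_scalar (@normCi C).

Definition Zn_set : set unitary_group :=
  [set A | exists2 l : C, (`|l| = 1)%R & U_val A = l%:M%R].

Lemma Zn_commute (A B : unitary_group) : Zn_set A -> commute A B.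
Proof.
by move=> [l _ Al]; apply: val_inj; rewrite /= Al scalar_mxC.
Qed.

Fact Zn_subgroup : subgroup Zn_set.
Proof.
apply/subgroupP; split=> [|A B [l l1 Al] [m m1 Bm]|A [l l1 Al]].
- by exists 1%R; rewrite ?normr1.
- by exists (l * m)%R; rewrite ?normrM ?l1 ?m1 ?mulr1 //= Al Bm -scalar_mxM.
- by exists (l^-1)%R; rewrite ?normfV ?l1 ?invr1 //= Al invmx_scalar.
Qed.

Fact Zn_conj (A B : unitary_group) : Zn_set A -> Zn_set (A ^ B).
Proof. by move=> ZA; rewrite /conjg (Zn_commute B ZA) mulgA mulVg mul1g. Qed.

Definition Zn : normal_subgroup unitary_group :=
  NormalSubgroup Zn_subgroup Zn_conj.

Fact U_negI_commute (A : unitary_group) : commute U_negI A.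
Proof. by apply: Zn_commute; exists (-1)%R; rewrite ?normrN1. Qed.

Definition negI_set : set unitary_group := generated [set U_negI].

Definition negI_group : normal_subgroup unitary_group :=
  NormalSubgroup (generated_subgroup [set U_negI])
    (generated1_central_conj U_negI_commute).

Definition PU : groupType := quotient_group Zn.
Definition UmodI : groupType := quotient_group negI_group.

Fact Zn_U_conj (A : unitary_group) : Zn_set A -> Zn_set (U_conj A).
Proof.
move=> [l l1 Al]; exists (l^* )%R; first by rewrite norm_conjC.
by rewrite /= Al map_scalar_mx.
Qed.

Fact negI_sub (H : set unitary_group) :
  subgroup H -> H U_negI -> negI_set `<=` H.
Proof. by move=> Hg HI A /(_ H); apply; split=> // B ->. Qed.

Fact negI_U_conj (A : unitary_group) : negI_set A -> negI_set (U_conj A).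
Proof.
have [H1 HM HV] := (subgroupP _).1 (generated_subgroup [set U_negI]).
have c1 : U_conj 1 = 1 by apply: val_inj; rewrite /= map_mx1.
apply: (@negI_sub [set A | negI_set (U_conj A)]).
  apply/subgroupP; split=> [|B D hB hD|B hB] /=.
  - by rewrite c1.
  - by rewrite U_conjM; exact: HM.
  - suff -> : U_conj B^-1 = (U_conj B)^-1 by exact: HV.
    by apply: (mulgI (U_conj B)); rewrite -U_conjM !mulgV.
have -> : [set A | negI_set (U_conj A)] U_negI = negI_set U_negI.
  congr (negI_set _); apply: val_inj.
  by rewrite /= map_scalar_mx /= rmorphN1.
by move=> H [_]; apply.
Qed.

Fact negI_Zn (A : unitary_group) : negI_set A -> Zn_set A.
Proof.
apply: negI_sub; first exact: Zn_subgroup.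
by exists (-1)%R; rewrite ?normrN1.
Qed.

Definition PU_conj_fun : PU -> PU := quot_map Zn U_conj.
Definition UmodI_conj_fun : UmodI -> UmodI := quot_map negI_group U_conj.

Lemma PU_conjE (A : unitary_group) :
  PU_conj_fun (quot_class Zn A) = quot_class Zn (U_conj A).
Proof. exact: (@quot_mapE _ _ Zn Zn _ U_conjM Zn_U_conj). Qed.

Lemma UmodI_conjE (A : unitary_group) :
  UmodI_conj_fun (quot_class negI_group A) = quot_class negI_group (U_conj A).
Proof.
exact: (@quot_mapE _ _ negI_group negI_group _ U_conjM negI_U_conj).
Qed.

Fact PU_conjM : {morph PU_conj_fun : x y / x * y}.
Proof.
move=> x y; have [A ->] := quot_classP x; have [B ->] := quot_classP y.
by rewrite -quot_classM !PU_conjE U_conjM quot_classM.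
Qed.

Fact PU_conjK : involutive PU_conj_fun.
Proof.
by move=> x; have [A ->] := quot_classP x; rewrite !PU_conjE U_conjK.
Qed.

Fact UmodI_conjM : {morph UmodI_conj_fun : x y / x * y}.
Proof.
move=> x y; have [A ->] := quot_classP x; have [B ->] := quot_classP y.
by rewrite -quot_classM !UmodI_conjE U_conjM quot_classM.
Qed.

Fact UmodI_conjK : involutive UmodI_conj_fun.
Proof.
by move=> x; have [A ->] := quot_classP x; rewrite !UmodI_conjE U_conjK.
Qed.

Definition PU_conj : involutive_aut PU := InvolutiveAut PU_conjM PU_conjK.
Definition UmodI_conj : involutive_aut UmodI :=
  InvolutiveAut UmodI_conjM UmodI_conjK.

Definition G : groupType := sdprod2 PU_conj.
Definition Gtilde : groupType := sdprod2 UmodI_conj.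

(* PU(n) is connected of index 2 in G, hence its neutral component *)
Definition G0 : set G := range (sd_embed PU_conj).

Definition pi' (x : Gtilde) : G :=
  ((quot_map Zn id : UmodI -> PU) x.1, x.2).

Definition U_image (S : set unitary_group) : set Gtilde :=
  [set sd_embed UmodI_conj (quot_class negI_group A) | A in S].

Definition Zn_mod_negI : set Gtilde := U_image Zn.
Definition iI_mod_negI : set Gtilde := U_image (generated [set U_iI]).

Lemma quot_map_idE (A : unitary_group) :
  quot_map Zn id (quot_class negI_group A) = quot_class Zn A.
Proof. by apply: quot_mapE => //; exact: negI_Zn. Qed.

Lemma pi'_embed (A : unitary_group) :
  pi' (sd_embed UmodI_conj (quot_class negI_group A)) =
  sd_embed PU_conj (quot_class Zn A).
Proof. by congr (_, _); exact: quot_map_idE. Qed.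

Lemma pi'_tau : pi' (sd_tau UmodI_conj) = sd_tau PU_conj.
Proof. by congr (_, _); exact: quot_map_idE. Qed.

Lemma pi'M : {morph pi' : x y / x * y}.
Proof.
move=> [x a] [y b]; congr (_, _) => /=.
have [A ->] := quot_classP x; have [B ->] := quot_classP y.
case: a => /=.
  by rewrite UmodI_conjE -quot_classM !quot_map_idE PU_conjE quot_classM.
by rewrite -quot_classM !quot_map_idE quot_classM.
Qed.

Lemma pi'_ker (x : Gtilde) : pi' x = 1 <-> Zn_mod_negI x.
Proof.
have [_ _ ZV] := (subgroupP _).1 Zn_subgroup.
split=> [|[A ZA <-]].
  case: x => x a []; have [A ->] := quot_classP x.
  rewrite quot_map_idE => A1 ->.
  exists A => //; move/eq_quot_class: A1; rewrite mulg1 => /ZV.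
  by rewrite invgK.
rewrite pi'_embed; congr (_, _); apply/eq_quot_class.
by rewrite mulg1; exact: ZV.
Qed.

Definition abelian_lift (F : set G) (F' : set Gtilde) : Prop :=
  [/\ subgroup F', abelian_set F', pi' @` F' = F &
      F' `&` Zn_mod_negI = iI_mod_negI].

End UnitaryGroup.

(* Main.v *)
Require Import Defs.
From mathcomp Require Import all_boot all_order all_algebra.
From mathcomp Require Import boolp classical_sets reals.
From mathcomp Require Import complex.

(** Write Z for Zn/<-I>. Elements of Gtilde outside the neutral component
    invert Z by conjugation, because complex conjugation inverts the unit
    circle. Fix s in Gtilde lying over an element of F outside G0. Every
    abelian lift of F containing s is contained in

      K(s) = { x over F : x commutes with s },

    and the proof consists in seeing that K(s) is itself the lift sought.

    - K(s) maps onto F: a lift x of an element of F commutes with s up to some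
      z in Z, and replacing x by w x changes z into w^2 z; the unit circle has
      square roots ([preimage_centralizer_onto]).
    - Since s inverts Z, K(s) meets Z in the elements equal to their inverse,
      that is the classes of l I with l^2 = 1 or l^2 = -1, and these are the
      classes of the powers of iI ([Zn_mod_negI_involution]).
    - K(s) is abelian ([preimage_centralizer_abelian]). Let A and D be
      unitary representatives of two elements of K(s) in the neutral component.
      Their commutator is a scalar c. Conjugation by s lifts to the semilinear
      automorphism X |-> B conj(X) B^-1 of U(n), which sends A and D to A and D
      up to sign; the signs cancel in the commutator, so c is equal to its
      conjugate, hence c = 1 or c = -1, and A, D commute modulo -I. Elements
      outside the neutral component are brought into it by dividing by s.

    For uniqueness, a lift containing s has the same image and the same
    intersection with Z as K(s), so it is K(s) ([abelian_lift_eq]). Two lifts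
    contain elements s1 and s2 = z s1 over the same element of F, and
    conjugation by a square root w of z maps s1 to w^2 s1 = s2, hence K(s1)
    onto K(s2). *)

Set Implicit Arguments.
Unset Strict Implicit.
Unset Printing Implicit Defensive.

Import Order.TTheory GRing.Theory Num.Theory.

Local Open Scope classical_set_scope.
Local Open Scope group_scope.

(** * Scalar unitary matrices *)

Section Scalars.
Variables (R : realType) (n : nat).
Local Notation C := R[i].
Local Notation U := (unitary_group R n).

Lemma negI_setP (A : U) :
  negI_set A <-> U_val A = 1%:M%R \/ U_val A = (-1)%:M%R.
Proof.
split.
  apply: (@negI_sub R n [set A : U | U_val A = 1%:M%R \/ U_val A = (-1)%:M%R]);
    last by right.
  apply/subgroupP; split=> [|x y hx hy|x hx] /=; first by left.
    case: hx hy => -> [] ->; rewrite -scalar_mxM ?mulrNN ?mulr1 ?mul1r;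
      by [left|right].
  by case: hx => ->; rewrite invmx_scalar ?invrN ?invr1; [left|right].
have [H1 _ _] := (subgroupP _).1 (generated_subgroup [set @U_negI R n]).
case=> hA.
  by suff -> : A = 1 by []; apply: val_inj.
have -> : A = @U_negI R n by apply: val_inj; rewrite /= hA.
by move=> H [_]; apply.
Qed.

Lemma iI_setP (A : U) :
  generated [set @U_iI R n] A <->
  exists2 l : C, U_val A = l%:M%R & (l ^+ 2 = 1 \/ l ^+ 2 = -1)%R.
Proof.
have [H1 HM HV] := (subgroupP _).1 (generated_subgroup [set @U_iI R n]).
have Hi : generated [set @U_iI R n] (@U_iI R n) by move=> H [_]; apply.
split.
  move/(_ [set A : U | exists2 l : C, U_val A = l%:M%R &
                         (l ^+ 2 = 1 \/ l ^+ 2 = -1)%R]); apply; split.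
    apply/subgroupP; split=> [|x y [l hl l2] [m hm m2]|x [l hl l2]] /=.
    - by exists 1%R => //; left; rewrite expr1n.
    - exists (l * m)%R; first by rewrite hl hm scalar_mxM.
      by rewrite exprMn; case: l2 m2 => -> [] ->;
        rewrite ?mulrNN ?mulr1 ?mul1r; [left|right|right|left].
    - exists (l^-1)%R; first by rewrite hl invmx_scalar.
      by rewrite exprVn; case: l2 => ->; rewrite ?invrN invr1; [left|right].
  by move=> _ -> /=; exists 'i%R => //; right; rewrite sqrCi.
case=> l hl [/eqP|/eqP l2].
  rewrite sqrf_eq1 => /orP[] /eqP l1.
    by suff -> : A = 1 by []; apply: val_inj; rewrite /= hl l1.
  suff -> : A = @U_iI R n * @U_iI R n by exact: HM.
  by apply: val_inj; rewrite /= hl l1 -scalar_mxM -expr2 sqrCi.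
move: l2; rewrite -(@sqrCi C) eqf_sqr => /orP[] /eqP l1.
  by suff -> : A = @U_iI R n by []; apply: val_inj; rewrite /= hl l1.
suff -> : A = (@U_iI R n)^-1 by exact: HV.
by apply: val_inj; rewrite /= hl l1 invmx_scalar invCi.
Qed.

Lemma scalar_mx_inj : (0 < n)%N -> injective (fun l : C => (l%:M%R : 'M_n)).
Proof.
move=> n0 l m /matrixP /(_ (Ordinal n0) (Ordinal n0)).
by rewrite !mxE eqxx !mulr1n.
Qed.

Lemma Zn_conjV (A : U) : Zn_set A -> U_conj A = A^-1.
Proof.
move=> [l l1 hl]; apply: val_inj; rewrite /= hl map_scalar_mx invmx_scalar /=.
by rewrite invC_norm l1 expr1n invr1 mul1r.
Qed.

Lemma Zn_sqrt (A : U) : Zn_set A -> exists2 B : U, Zn_set B & B * B = A.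
Proof.
move=> [l l1 hl].
have m1 : `|sqrtC l|%R = 1%R :> C.
  by apply/eqP; rewrite -(@eqrXn2 _ 2) ?normr_ge0 // -normrX sqrtCK l1 expr1n.
exists (@U_scalar R n _ m1); first by exists (sqrtC l).
by apply: val_inj; rewrite /= hl -scalar_mxM -expr2 sqrtCK.
Qed.

End Scalars.

(** * The action of Gtilde on Zn/<-I> *)

Section Gtilde.
Variables (R : realType) (n : nat).
Local Notation C := R[i].
Local Notation U := (unitary_group R n).
Local Notation Gt := (Gtilde R n).
Local Notation cls := (quot_class (negI_group R n)).
Local Notation ZI := (@Zn_mod_negI R n).

Lemma pi'_surj : forall f : G R n, exists x : Gt, pi' x = f.
Proof.
move=> [f b]; have [A ->] := quot_classP f.
by exists (cls A, b); congr (_, _); exact: quot_map_idE.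
Qed.

Lemma pi'1 : pi' (1 : Gt) = 1.
Proof. by apply: (mulgI (pi' (1 : Gt))); rewrite -pi'M !mulg1. Qed.

Lemma pi'V (x : Gt) : pi' x^-1 = (pi' x)^-1.
Proof. by apply: (mulgI (pi' x)); rewrite -pi'M !mulgV pi'1. Qed.

Lemma pi'_eq (x y : Gt) : pi' x = pi' y -> ZI (x * y^-1).
Proof. by move=> xy; apply/pi'_ker; rewrite pi'M pi'V xy mulgV. Qed.

Lemma Zn_mod_negI_subgroup : subgroup ZI.
Proof.
apply/subgroupP; split=> [|x y|x]; rewrite -!pi'_ker ?pi'1 //.
  by rewrite pi'M => -> ->; rewrite mulg1.
by rewrite pi'V => ->; rewrite invg1.
Qed.

(** Complex conjugation inverts scalars of modulus 1; scalars being central, the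
    unitary part of s acts trivially on them. *)
Lemma Zn_mod_negI_twist (z s : Gt) : ZI z -> s.2 = true -> s * z = z^-1 * s.
Proof.
case: s => s b [A ZA <-] /= ->; have [D ->] := quot_classP s.
have clsV : (cls A)^-1 = cls A^-1 by exact: quot_invE.
congr (_, _); rewrite /= UmodI_conjE clsV -!quot_classM Zn_conjV //.
have [_ _ HV] := (subgroupP _).1 (@Zn_subgroup R n).
by rewrite (Zn_commute D (HV _ ZA)).
Qed.

Lemma Zn_mod_negI_sqrt (z : Gt) : ZI z -> exists2 w, ZI w & w * w = z.
Proof.
move=> [A ZA <-]; have [B ZB BA] := Zn_sqrt ZA.
exists (sd_embed (UmodI_conj R n) (cls B)); first by exists B.
by rewrite -sd_embedM -quot_classM BA.
Qed.

Lemma Zn_mod_negI_involution (z : Gt) :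
  (0 < n)%N -> ZI z -> z * z = 1 <-> @iI_mod_negI R n z.
Proof.
move=> n0; have sqE (A : U) l : U_val A = l%:M%R ->
    (sd_embed (UmodI_conj R n) (cls A) * sd_embed (UmodI_conj R n) (cls A) = 1)
    <-> (l ^+ 2 = 1 \/ l ^+ 2 = -1)%R.
  move=> hl; have hAA : U_val (A * A) = (l ^+ 2)%:M%R.
    by rewrite /= hl -scalar_mxM expr2.
  have -> : (sd_embed (UmodI_conj R n) (cls A) *
      sd_embed (UmodI_conj R n) (cls A) = 1) <-> negI_set (A * A).
    rewrite -sd_embedM -quot_classM; split=> [[/esym/eq_quot_class]|h].
      by rewrite invg1 mul1g.
    by congr (_, _); apply/esym/eq_quot_class; rewrite invg1 mul1g.
  rewrite negI_setP hAA.
  by split=> [] [h|h]; [left|right|left|right]; rewrite ?h //;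
    exact: (scalar_mx_inj n0).
move=> [A [l l1 hl] <-]; rewrite (sqE _ _ hl); split=> [h|].
  by exists A => //; apply/iI_setP; exists l.
(* the representative B in <iI> may differ from A by a sign, but squaring to 1
   depends only on the common class *)
by move=> [B /iI_setP[m hm m2] BA]; rewrite -(sqE _ _ hl) -BA (sqE _ _ hm).
Qed.

Lemma iI_mod_negI_sub : @iI_mod_negI R n `<=` ZI.
Proof.
move=> _ [A hA <-]; exists A => //.
apply: hA; split; first exact: Zn_subgroup.
by move=> _ ->; exists 'i%R; rewrite ?normCi.
Qed.

(** * The centralizer of a lift in the preimage of F *)

Definition preimage_centralizer (F : set (G R n)) (s : Gt) : set Gt :=
  [set x | F (pi' x) /\ commute x s].

Lemma preimage_centralizer_subgroup F s :
  subgroup F -> subgroup (preimage_centralizer F s).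
Proof.
move=> /subgroupP[F1 FM FV].
apply/subgroupP; split=> [|x y [Fx xs] [Fy ys]|x [Fx xs]].
- by split; [rewrite pi'1|exact/commute_sym/commute1].
- split; first by rewrite pi'M; exact: FM.
  by apply/commute_sym/commuteM; exact/commute_sym.
- split; first by rewrite pi'V; exact: FV.
  by apply/commute_sym/commuteV; exact/commute_sym.
Qed.

(** The commutator of x with s lies in the kernel; multiplying x by w in the
    kernel multiplies it by w^2, since s inverts w. The square root is chosen so
    that w^2 cancels the commutator. *)
Lemma preimage_centralizer_onto F s :
  abelian_set F -> F (pi' s) -> s.2 = true ->
  @pi' R n @` preimage_centralizer F s = F.
Proof.
move=> F_ab Fs s2; apply/seteqP; split=> [_ [x [Fx _] <-] //|f Ff].
have [x xf] := pi'_surj f.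
have Zc : ZI ((s * x) * (x * s)^-1).
  by apply: pi'_eq; rewrite !pi'M; apply: F_ab => //; rewrite xf.
have [w Zw wc] := Zn_mod_negI_sqrt Zc.
have wf : pi' (w * x) = f by rewrite pi'M ((pi'_ker _).2 Zw) mul1g.
exists (w * x) => //; split; first by rewrite wf.
rewrite /commute mulgA (Zn_mod_negI_twist Zw s2) -!mulgA.
apply: (mulgI w); rewrite mulVKg.
by rewrite (mulgA w w) wc mulgVK.
Qed.

Lemma preimage_centralizer_Zn F s :
  (0 < n)%N -> subgroup F -> s.2 = true ->
  preimage_centralizer F s `&` ZI = @iI_mod_negI R n.
Proof.
move=> n0 /subgroupP[F1 _ _] s2.
have commE z : ZI z -> commute z s <-> z * z = 1.
  move=> Zz; rewrite /commute (Zn_mod_negI_twist Zz s2).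
  split=> [/mulIg {1}->|zz].
    by rewrite mulVg.
  by congr (_ * _); apply: (mulgI z); rewrite mulgV.
apply/seteqP; split=> [z [[_ zs] Zz]|z iz].
  by apply/(Zn_mod_negI_involution n0 Zz)/commE.
have Zz := iI_mod_negI_sub iz.
split=> //; split; first by rewrite ((pi'_ker _).2 Zz).
by apply/(commE _ Zz)/(Zn_mod_negI_involution n0 Zz).
Qed.

(** The semilinear automorphism X |-> B conj(X) B^-1 sends the scalar
    c = [A, D] to c^-1. It also fixes c, because the signs acquired by A and D
    cancel in their commutator. So c^2 = 1 and c is in <-I>. *)
Lemma cls_commute_of_semilinear (A B D : U) :
  (0 < n)%N -> Zn_set (A * D * (D * A)^-1) ->
  cls A * cls B = cls B * cls (U_conj A) ->
  cls D * cls B = cls B * cls (U_conj D) ->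
  commute (cls A) (cls D).
Proof.
move=> n0; set c := _ * _^-1 => Zc hA hD.
have cE : A * D = c * (D * A) by rewrite /c mulgVK.
have sign X : cls X * cls B = cls B * cls (U_conj X) ->
    exists2 e, negI_set e & B * U_conj X = e * (X * B).
  rewrite -!quot_classM => /eq_quot_class h.
  exists ((X * B)^-1 * (B * U_conj X)) => //.
  by rewrite (Zn_commute (X * B) (negI_Zn h)) mulVKg.
have [e /negI_Zn Ze eE] := sign _ hA; have [f /negI_Zn Zf fE] := sign _ hD.
have moveZ z x y : Zn_set z -> x * (z * y) = z * (x * y) :> U.
  by move=> Zz; rewrite !mulgA (Zn_commute x Zz).
have adE : B * (U_conj A * U_conj D) = e * (f * (A * D * B)).
  by rewrite mulgA eE -!mulgA fE (moveZ f A) //.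
have daE : B * (U_conj D * U_conj A) = e * (f * (D * A * B)).
  by rewrite mulgA fE -!mulgA eE (moveZ e D) // (moveZ e f) //.
have ZcV : Zn_set c^-1 by case/subgroupP: (@Zn_subgroup R n) => _ _; apply.
have cV : c = c^-1.
  have : A * D = c^-1 * (D * A).
    apply: (mulIg B); apply: (mulgI f); apply: (mulgI e).
    rewrite -adE -U_conjM cE U_conjM Zn_conjV // (moveZ c^-1) // U_conjM daE.
    by rewrite -(mulgA c^-1) (moveZ c^-1 f) // (moveZ c^-1 e).
  by rewrite {1}cE => /mulIg.
have [l l1 hl] := Zc.
have nc : negI_set c.
  have : (l ^+ 2)%:M%R = 1%:M%R :> 'M[C]_n.
    by rewrite expr2 scalar_mxM -hl -[RHS]/(U_val 1) -(mulgV c) -cV.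
  move/(scalar_mx_inj n0)/eqP; rewrite sqrf_eq1 => l2.
  by apply/negI_setP; rewrite hl; case/orP: l2 => /eqP ->; [left|right].
rewrite /commute -!quot_classM; apply/esym/eq_quot_class.
by rewrite cE (Zn_commute _ Zc) mulKg.
Qed.

Lemma preimage_centralizer_abelian F s :
  (0 < n)%N -> subgroup F -> abelian_set F -> F (pi' s) -> s.2 = true ->
  abelian_set (preimage_centralizer F s).
Proof.
move=> n0 F_grp F_ab Fs s2; have [_ FM FV] := (subgroupP _).1 F_grp.
(* it is enough to treat elements of the neutral component: a general element
   is one of these times a power of s *)
have neutral x y : F (pi' x) -> F (pi' y) -> commute x s -> commute y s ->
    x.2 = false -> y.2 = false -> commute x y.
  case: x y s s2 {Fs} => x bx [y by_] [s bs] /= -> Fx Fy xs ys bx0 by0.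
  move: Fx Fy xs ys; rewrite {}bx0 {}by0.
  have [A ->] := quot_classP x; have [D ->] := quot_classP y.
  have [B ->] := quot_classP s => FA FD [hA] [hD].
  suff hAD : commute (cls A) (cls D) by congr (_, _).
  move: hA hD; rewrite /= !UmodI_conjE; apply: cls_commute_of_semilinear => //.
  have [] := F_ab _ _ FA FD; rewrite /= !quot_map_idE -!quot_classM.
  move/esym/eq_quot_class => /(normal_conj (D * A)^-1).
  by rewrite /conjg invgK -(mulgA (D * A)^-1) mulVKg.
have divide_s x : F (pi' x) -> commute x s ->
    exists2 u, x = u \/ x = u * s & [/\ F (pi' u), commute u s & u.2 = false].
  move=> Fx xs; case x2: x.2; last by exists x; [left|split].
  exists (x * s^-1); first by right; rewrite mulgVK.
  split; first by rewrite pi'M pi'V; exact/FM/FV.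
    by rewrite /commute mulgVK mulgA -xs mulgK.
  by rewrite /= x2 s2.
move=> x y [Fx xs] [Fy ys].
have [u xE [Fu us u2]] := divide_s _ Fx xs.
have [v yE [Fv vs v2]] := divide_s _ Fy ys.
have uv : commute u v by apply: neutral.
have uy : commute u y by case: yE => -> //; apply: commuteM.
case: xE => -> //.
by apply/commute_sym/commuteM; apply/commute_sym => //; exact/commute_sym.
Qed.

(** * Abelian lifts *)

Lemma preimage_centralizer_lift F s :
  (0 < n)%N -> subgroup F -> abelian_set F -> F (pi' s) -> s.2 = true ->
  abelian_lift F (preimage_centralizer F s).
Proof.
move=> n0 F_grp F_ab Fs s2; split.
- exact: preimage_centralizer_subgroup.
- exact: preimage_centralizer_abelian.
- exact: preimage_centralizer_onto.
- exact: preimage_centralizer_Zn.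
Qed.

(** A lift is contained in the centralizer of each of its elements, and both
    subgroups have the same image and the same intersection with the kernel. *)
Lemma abelian_lift_eq F (F' : set Gt) s :
  (0 < n)%N -> subgroup F -> s.2 = true -> abelian_lift F F' -> F' s ->
  F' = preimage_centralizer F s.
Proof.
move=> n0 F_grp s2 [F'_grp F'_ab F'_im F'_Z] F's.
have sub : F' `<=` preimage_centralizer F s.
  by move=> x F'x; split; [rewrite -F'_im; exists x|exact: F'_ab].
apply/seteqP; split=> // x Kx.
have [y F'y yx] : (@pi' R n @` F') (pi' x) by rewrite F'_im; case: Kx.
have [_ F'M _] := (subgroupP _).1 F'_grp.
have [_ KM KV] := (subgroupP _).1 (preimage_centralizer_subgroup s F_grp).
have [F'xy _] : (F' `&` ZI) (x * y^-1).
  rewrite F'_Z -(preimage_centralizer_Zn n0 F_grp s2).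
  by split; [apply/KM/KV/sub|exact: pi'_eq].
by rewrite -(mulgVK y x); exact: F'M.
Qed.

Lemma preimage_centralizer_conj F (w s : Gt) :
  pi' w = 1 ->
  conj_set w (preimage_centralizer F s) =
  preimage_centralizer F (w * s * w^-1).
Proof.
have conjP (u x t : Gt) : pi' u = 1 ->
    preimage_centralizer F t x ->
    preimage_centralizer F (u * t * u^-1) (u * x * u^-1).
  move=> u1 [Fx xt]; split.
    by rewrite !pi'M pi'V u1 invg1 mulg1 mul1g.
  by rewrite /commute !mulgA !mulgVK -(mulgA u) xt !mulgA.
move=> w1; apply/seteqP; split=> [_ [x Kx <-]|x Kx]; first exact: conjP.
have w1V : pi' w^-1 = 1 by rewrite pi'V w1 invg1.
exists (w^-1 * x * w^-1^-1); last by rewrite invgK !mulgA mulgV mul1g mulgK.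
by have := conjP _ _ _ w1V Kx; rewrite invgK !mulgA mulVg mul1g mulgVK.
Qed.

End Gtilde.

Theorem lemma5p6 (R : realType) (n : nat) (hn : (2 <= n)%N)
    (F : set (G R n)) (F_grp : subgroup F) (F_ab : abelian_set F)
    (F_not_G0 : ~ (F `<=` @G0 R n)) :
  (exists F' : set (Gtilde R n), abelian_lift F F') /\
  (forall F1 F2 : set (Gtilde R n), abelian_lift F F1 -> abelian_lift F F2 ->
     exists2 z, @Zn_mod_negI R n z & F2 = conj_set z F1).
Proof.
have n0 : (0 < n)%N by exact: ltnW.
have [f Ff f2] : exists2 f : G R n, F f & f.2 = true.
  apply: contrapT => F_false; apply: F_not_G0 => -[g b] Fg.
  case: b Fg => Fg; last by exists g.
  by case: F_false; exists (g, true).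
have over_f (s : Gtilde R n) : pi' s = f -> s.2 = true.
  by move=> sf; rewrite -f2 -sf.
split.
  have [s sf] := pi'_surj f; exists (preimage_centralizer F s).
  by apply: preimage_centralizer_lift; rewrite ?sf //; exact: over_f.
move=> F1 F2 lift1 lift2.
have [s1 F1s1 s1f] : (@pi' R n @` F1) f by case: lift1 => _ _ -> _.
have [s2 F2s2 s2f] : (@pi' R n @` F2) f by case: lift2 => _ _ -> _.
have Zz : @Zn_mod_negI R n (s2 * s1^-1) by apply: pi'_eq; rewrite s1f.
have [w Zw wE] := Zn_mod_negI_sqrt Zz.
exists w => //.
rewrite (abelian_lift_eq n0 F_grp (over_f _ s1f) lift1 F1s1).
rewrite (abelian_lift_eq n0 F_grp (over_f _ s2f) lift2 F2s2).
rewrite preimage_centralizer_conj; last exact/pi'_ker.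
have [_ _ ZV] := (subgroupP _).1 (@Zn_mod_negI_subgroup R n).
rewrite -mulgA (Zn_mod_negI_twist (ZV _ Zw) (over_f _ s1f)) invgK mulgA wE.
by rewrite mulgVK.
Qed.
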